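(* Let $(X,t)$ be an NPLTS. If $x,y\in X$ are probabilistic bisimilar, or convex probabilistic bisimilar, then $x\equiv y$, $x\equiv_B y$ and $x\equiv_T y$.
   Context: $A$ is a set of labels; $\mathcal{D}X$ is the set of finitely supported probability distributions on $X$, $\delta_x$ the Dirac distribution; $\mathrm{conv}$ denotes convex hull. An NPLTS is a pair $(X,t)$ with $t\colon X\to(\mathcal{P}\mathcal{D}X)^A$, each $t(x)(a)$ a finite set of distributions. For an equivalence relation $R$ on $X$, distributions $\Delta,\Delta'$ are $R$-related if $\Delta(E)=\Delta'(E)$ for every $R$-equivalence class $E$. $R$ is a probabilistic bisimulation if whenever $xRy$ and $\Delta\in t(x)(a)$ there is $\Delta'\in t(y)(a)$ $R$-related to $\Delta$; it is a convex probabilistic bisimulation if whenever $xRy$ and $\Delta\in t(x)(a)$ there is $\Delta'\in\mathrm{conv}(t(y)(a))$ $R$-related to $\Delta$. Two states are (convex) probabilistic bisimilar if related by some (convex) probabilistic bisimulation. Trace semantics: terms $s::=x\ (x\in X)\mid\star\mid s\oplus s\mid s+_ps\ (p\in[0,1])$; for a finite set $S$ of distributions, $\tau(S)=\star$ if $S=\emptyset$ and $\tau(S)=d_1\oplus\cdots\oplus d_n$ if $S=\{\Delta_1,\dots,\Delta_n\}$, each $d_i$ a $+_p$-term over $X$ denoting $\Delta_i$ (reading $x$ as $\delta_x$, $+_p$ as $p\Phi+(1-p)\Psi$; the semantics does not depend on these choices). For each label $a$: $x^a=\tau(t(x)(a))$, $\star^a=\star$, $(s_1\oplus s_2)^a=s_1^a\oplus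 s_2^a$, $(s_1+_ps_2)^a=s_1^a+_ps_2^a$; $s^\varepsilon=s$, $s^{aw}=(s^a)^w$. Outputs: $o_B$: $x\mapsto1$, $\star\mapsto0$, $\oplus\mapsto\max$, $+_p\mapsto p\cdot-+(1-p)\cdot-$; $o_T$: the same with $\min$; $o$ with values in closed intervals $[u,v]\subseteq[0,1]$: $x\mapsto[1,1]$, $\star\mapsto[0,0]$, $\oplus\mapsto([u_1,v_1],[u_2,v_2])\mapsto[\min(u_1,u_2),\max(v_1,v_2)]$, $+_p\mapsto$ endpoint-wise convex combination. $x\equiv y$ iff $o(x^w)=o(y^w)$ for all $w\in A^*$ (may-must trace equivalence); $x\equiv_B y$ iff $o_B(x^w)=o_B(y^w)$ for all $w$ (may); $x\equiv_T y$ iff $o_T(x^w)=o_T(y^w)$ for all $w$ (must). *)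

(* Defs.v *)
From HB Require Import structures.
From mathcomp Require Import all_boot all_order all_algebra.
From mathcomp Require Import mathcomp_extra boolp classical_sets functions.
From mathcomp Require Import cardinality fsbigop reals interval_inference.
From mathcomp Require Import ring lra.

Set Implicit Arguments.
Unset Strict Implicit.
Unset Printing Implicit Defensive.

Import Order.TTheory GRing.Theory Num.Theory.

Local Open Scope classical_set_scope.
Local Open Scope ring_scope.

Section FinitelySupportedDistributions.
Variables (R : realType) (X : choiceType).

(* Sums over subsets of X are the finitely supported sums of fsbigop, which
   default to 0 on infinite supports; mass_finite excludes that case. *)
Record dist := Dist {
  mass :> X -> R ;
  mass_ge0 : forall x, 0 <= mass x ;
  mass_finite : finite_set [set x | mass x != 0] ;
  mass_sum1 : \sum_(x \in setT) mass x = 1 }.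

Lemma dist_eq (D1 D2 : dist) : D1 =1 D2 -> D1 = D2.
Proof.
case: D1 D2 => [m1 a1 b1 c1] [m2 a2 b2 c2] /= /funext m12; subst m2.
by congr Dist; exact: Prop_irrelevance.
Qed.

Definition prob (D : dist) (E : set X) : R := \sum_(x \in E) D x.

Lemma sum_supp (f : X -> R) (s : seq X) : uniq s ->
  (forall x, f x != 0 -> x \in s) -> \sum_(x \in setT) f x = \sum_(x <- s) f x.
Proof.
move=> us fs; rewrite (fsbig_seq _ _ us); apply/esym/fsbig_widen => //.
by move=> x [_ /= xs]; have [//|/fs] := eqVneq (f x) 0.
Qed.

Lemma finite_supp_seq (f : X -> R) : finite_set [set x | f x != 0] ->
  exists2 s : seq X, uniq s & forall x, f x != 0 -> x \in s.
Proof.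
move=> /finite_seqP[s fs]; exists (undup s); first exact: undup_uniq.
by move=> x fx0; rewrite mem_undup; have : [set` s] x by rewrite -fs.
Qed.

Lemma dirac_sum1 (x : X) : \sum_(y \in setT) ((y == x)%:R : R) = 1.
Proof.
rewrite (@sum_supp _ [:: x]) //; first by rewrite big_seq1 eqxx.
by move=> y /=; rewrite inE; have [//|_] := eqVneq y x; rewrite eqxx.
Qed.

Lemma dirac_finite (x : X) : finite_set [set y | (y == x)%:R != 0 :> R].
Proof.
apply: (sub_finite_set _ (finite_set1 x)) => y /=.
by have [//|_] := eqVneq y x; rewrite eqxx.
Qed.

Definition dirac (x : X) : dist :=
  Dist (fun y => ler0n R (y == x)) (dirac_finite x) (dirac_sum1 x).

Section Mix.
Variables (p : {i01 R}) (D1 D2 : dist).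

Let m (x : X) : R := p%:num * D1 x + (1 - p%:num) * D2 x.

Lemma mix_ge0 x : 0 <= m x.
Proof.
by rewrite addr_ge0 // mulr_ge0 ?mass_ge0 // subr_ge0.
Qed.

Lemma mix_finite : finite_set [set x | m x != 0].
Proof.
apply: (@sub_finite_set _ _ ([set x | D1 x != 0] `|` [set x | D2 x != 0])).
  move=> x /=; rewrite /m; have [->|//] := eqVneq (D1 x) 0; last by left.
  have [->|//] := eqVneq (D2 x) 0; last by right.
  by rewrite !mulr0 addr0 eqxx.
by rewrite finite_setU; split; exact: mass_finite.
Qed.

Lemma mix_sum1 : \sum_(x \in setT) m x = 1.
Proof.
have [s1 u1 h1] := finite_supp_seq (mass_finite D1).
have [s2 u2 h2] := finite_supp_seq (mass_finite D2).
pose s := undup (s1 ++ s2).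
have us : uniq s by exact: undup_uniq.
have hs1 x : D1 x != 0 -> x \in s.
  by move=> /h1; rewrite mem_undup mem_cat => ->.
have hs2 x : D2 x != 0 -> x \in s.
  by move=> /h2; rewrite mem_undup mem_cat => ->; rewrite orbT.
have hs x : m x != 0 -> x \in s.
  rewrite /m; have [-> |/hs1//] := eqVneq (D1 x) 0.
  have [-> |/hs2//] := eqVneq (D2 x) 0.
  by rewrite !mulr0 addr0 eqxx.
rewrite (sum_supp us hs) big_split /= -!mulr_sumr.
rewrite -(sum_supp us hs1) -(sum_supp us hs2) !mass_sum1; lra.
Qed.

Definition mix : dist := Dist mix_ge0 mix_finite mix_sum1.
End Mix.

Definition conv_hull (S : set dist) : set dist :=
  [set D | exists (n : nat) (p : 'I_n -> R) (F : 'I_n -> dist),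
     [/\ forall i, 0 <= p i, \sum_i p i = 1, forall i, S (F i)
       & forall x, D x = \sum_i p i * F i x]].

End FinitelySupportedDistributions.

Arguments dirac {R X}.

Record nplts (R : realType) (A : Type) (X : choiceType) := NPLTS {
  trans :> X -> A -> set (dist R X) ;
  trans_finite : forall x a, finite_set (trans x a) }.

Section Bisimulation.
Variables (R : realType) (A : Type) (X : choiceType).

Definition is_class (E : X -> X -> Prop) (C : set X) : Prop :=
  exists x, C = [set y | E x y].

Definition dist_related (E : X -> X -> Prop) (D D' : dist R X) : Prop :=
  forall C, is_class E C -> prob D C = prob D' C.

Variable t : nplts R A X.

Definition prob_bisimulation (E : X -> X -> Prop) : Prop :=
  RelationClasses.Equivalence E /\
  forall x y, E x y -> forall a D, t x a D ->
    exists2 D', t y a D' & dist_related E D D'.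

Definition convex_prob_bisimulation (E : X -> X -> Prop) : Prop :=
  RelationClasses.Equivalence E /\
  forall x y, E x y -> forall a D, t x a D ->
    exists2 D', conv_hull (t y a) D' & dist_related E D D'.

Definition prob_bisimilar (x y : X) : Prop :=
  exists2 E, prob_bisimulation E & E x y.

Definition convex_prob_bisimilar (x y : X) : Prop :=
  exists2 E, convex_prob_bisimulation E & E x y.

End Bisimulation.

Inductive term (R : realType) (X : Type) : Type :=
| Var of X
| Star
| Oplus of term R X & term R X
| Plus of {i01 R} & term R X & term R X.
Arguments Var {R X}.
Arguments Star {R X}.

Section TermsOfSets.
Variables (R : realType) (X : choiceType).

(* [denotes d D]: d is built from variables and the [Plus p] only, and its
   interpretation as a distribution is D. *)
Inductive denotes : term R X -> dist R X -> Prop :=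
| denotes_var x : denotes (Var x) (dirac x)
| denotes_plus p d1 d2 D1 D2 : denotes d1 D1 -> denotes d2 D2 ->
    denotes (Plus p d1 d2) (mix p D1 D2).

(* [is_tau S s]: s is one of the admissible values of tau(S), for some
   enumeration D_1, ..., D_n of S and some d_i denoting D_i; the n-fold sum
   d_1 (+) ... (+) d_n is bracketed to the left. Repetitions in the
   enumeration are allowed. *)
Inductive is_tau : set (dist R X) -> term R X -> Prop :=
| is_tau_empty : is_tau set0 Star
| is_tau_sum D Ds d ds : List.Forall2 denotes (d :: ds) (D :: Ds) ->
    is_tau [set D' | List.In D' (D :: Ds)] (foldl (@Oplus R X) d ds).

(* A function tau that has fixed all these choices. *)
Definition is_tau_choice (tau : set (dist R X) -> term R X) : Prop :=
  forall S, finite_set S -> is_tau S (tau S).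

Lemma denotes_exists (D : dist R X) : exists d, denotes d D.
Proof.
have [s us hs] := finite_supp_seq (mass_finite D).
elim: s D us hs => [|x s IH] D us hs.
  have := mass_sum1 D; rewrite (sum_supp us hs) big_nil => /esym/eqP.
  by rewrite oner_eq0.
have sumD := mass_sum1 D; rewrite (sum_supp us hs) big_cons in sumD.
move: (us) => /= /andP[xs us'].
have Dx0 := mass_ge0 D x.
have s0 : 0 <= \sum_(y <- s) D y by apply: sumr_ge0 => y _; exact: mass_ge0.
have Dx1 : D x <= 1 by lra.
have [Dx|Dxn1] := eqVneq (D x) 1.
  exists (Var x); suff -> : D = dirac x by constructor.
  apply: dist_eq => y /=; have [-> //|yx] := eqVneq y x.
  have [//|Dy] := eqVneq (D y) 0.
  have ys : y \in s by have := hs y Dy; rewrite inE (negbTE yx).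
  have : \sum_(y <- s) D y == 0 by apply/eqP; lra.
  rewrite psumr_eq0; last by move=> ? _; exact: mass_ge0.
  by move=> /allP/(_ y ys)/eqP.
have q0 : 0 < 1 - D x by rewrite subr_gt0 lt_neqAle Dxn1.
pose m y := if y == x then 0 else D y / (1 - D x).
have m_ge0 y : 0 <= m y.
  by rewrite /m; case: ifP => // _; rewrite divr_ge0 ?mass_ge0 // ltW.
have ms y : m y != 0 -> y \in s.
  rewrite /m; have [_|yx] := eqVneq y x; first by rewrite eqxx.
  have [->|Dy] := eqVneq (D y) 0; first by rewrite mul0r eqxx.
  by have := hs y Dy; rewrite inE (negbTE yx).
have m_fin : finite_set [set y | m y != 0].
  apply: (@sub_finite_set _ _ [set` s]); last exact: finite_seq.
  by move=> y /= /ms.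
have m_sum : \sum_(y \in setT) m y = 1.
  rewrite (sum_supp us' ms).
  have -> : \sum_(y <- s) m y = \sum_(y <- s) D y / (1 - D x).
    apply: eq_big_seq => y ys; rewrite /m.
    by have [yx|//] := eqVneq y x; rewrite -yx ys in xs.
  rewrite -mulr_suml (_ : \sum_(y <- s) D y = 1 - D x); last by lra.
  by rewrite divff // gt_eqF.
have [d' dD'] := IH (Dist m_ge0 m_fin m_sum) us' ms.
pose p : {i01 R} := Itv01 Dx0 Dx1.
have pE : p%:num = D x by [].
clearbody p; exists (Plus p (Var x) d').
suff -> : D = mix p (dirac x) (Dist m_ge0 m_fin m_sum).
  by constructor=> //; constructor.
apply: dist_eq => y /=; rewrite /m pE; have [->|yx] := eqVneq y x.
  by rewrite mulr1 mulr0 addr0.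
by rewrite mulr0 add0r mulrC divfK // gt_eqF.
Qed.

(* [is_tau_choice] is satisfiable. *)
Lemma tau_choice_exists : exists tau, is_tau_choice tau.
Proof.
have [den denP] := choice denotes_exists.
have H S : exists s, finite_set S -> is_tau S s.
  have [fS|nfS] := pselect (finite_set S); last by exists Star.
  have /(@finite_seqP {classic (dist R X)})[Ds SE] := fS.
  have {SE} -> : S = [set D | List.In D Ds].
    rewrite SE; apply/seteqP; split=> D /=; elim: Ds {SE} => //= D' Ds IH.
      by rewrite inE => /orP[/eqP ->|/IH]; [left|right].
    by rewrite inE => -[->|/IH ->]; rewrite ?eqxx ?orbT.
  case: Ds => [|D Ds].
    exists Star => _; rewrite (_ : [set _ | _] = set0); first by constructor.
    by apply/seteqP; split.
  exists (foldl (@Oplus R X) (den D) (map den Ds)) => _; constructor.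
  constructor=> //; elim: Ds => [|D' Ds IH] /=; first by constructor.
  by constructor.
have [tau tauP] := choice H; exists tau => S; exact: tauP.
Qed.

Section Traces.
Variables (A : Type) (t : nplts R A X) (tau : set (dist R X) -> term R X).

(* s^a *)
Fixpoint step (a : A) (s : term R X) : term R X :=
  match s with
  | Var x => tau (t x a)
  | Star => Star
  | Oplus s1 s2 => Oplus (step a s1) (step a s2)
  | Plus p s1 s2 => Plus p (step a s1) (step a s2)
  end.

(* s^w *)
Fixpoint run (s : term R X) (w : seq A) : term R X :=
  if w is a :: w' then run (step a s) w' else s.

End Traces.

End TermsOfSets.

Section Outputs.
Variable R : realType.

(* The closed intervals [lo, hi] included in [0, 1], given by endpoints. *)
Record itv01 := Itv01Of {
  lo : R ;
  hi : R ;
  itv01_bounds : [&& 0 <= lo, lo <= hi & hi <= 1] }.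

Lemma itv01_one_bounds : [&& 0 <= 1 :> R, 1 <= 1 :> R & 1 <= 1 :> R].
Proof. by rewrite ler01 lexx. Qed.

Lemma itv01_zero_bounds : [&& 0 <= 0 :> R, 0 <= 0 :> R & 0 <= 1 :> R].
Proof. by rewrite ler01 lexx. Qed.

Lemma itv01_join_bounds (I J : itv01) :
  [&& 0 <= Num.min (lo I) (lo J),
      Num.min (lo I) (lo J) <= Num.max (hi I) (hi J)
    & Num.max (hi I) (hi J) <= 1].
Proof.
case: I J => [u1 v1 /= /and3P[? uv1 ?]] [u2 v2 /= /and3P[? ? ?]].
rewrite le_min ge_max; apply/and3P; split; try by apply/andP.
by rewrite ge_min !le_max uv1.
Qed.

Lemma itv01_mix_bounds (p : {i01 R}) (I J : itv01) :
  [&& 0 <= p%:num * lo I + (1 - p%:num) * lo J,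
      p%:num * lo I + (1 - p%:num) * lo J
        <= p%:num * hi I + (1 - p%:num) * hi J
    & p%:num * hi I + (1 - p%:num) * hi J <= 1].
Proof.
case: I J => [u1 v1 /= /and3P[? ? ?]] [u2 v2 /= /and3P[? ? ?]].
have p0 : 0 <= p%:num by [].
have p1 : 0 <= 1 - p%:num by rewrite subr_ge0.
by apply/and3P; split; nra.
Qed.

Definition itv01_join (I J : itv01) : itv01 := Itv01Of (itv01_join_bounds I J).
Definition itv01_mix (p : {i01 R}) (I J : itv01) : itv01 :=
  Itv01Of (itv01_mix_bounds p I J).

Variable X : Type.

Fixpoint out_may (s : term R X) : R :=
  match s with
  | Var _ => 1
  | Star => 0
  | Oplus s1 s2 => Num.max (out_may s1) (out_may s2)
  | Plus p s1 s2 => p%:num * out_may s1 + (1 - p%:num) * out_may s2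
  end.

Fixpoint out_must (s : term R X) : R :=
  match s with
  | Var _ => 1
  | Star => 0
  | Oplus s1 s2 => Num.min (out_must s1) (out_must s2)
  | Plus p s1 s2 => p%:num * out_must s1 + (1 - p%:num) * out_must s2
  end.

Fixpoint out_may_must (s : term R X) : itv01 :=
  match s with
  | Var _ => Itv01Of itv01_one_bounds
  | Star => Itv01Of itv01_zero_bounds
  | Oplus s1 s2 => itv01_join (out_may_must s1) (out_may_must s2)
  | Plus p s1 s2 => itv01_mix p (out_may_must s1) (out_may_must s2)
  end.

End Outputs.

Section TraceEquivalences.
Variables (R : realType) (A : Type) (X : choiceType).
Variables (t : nplts R A X) (tau : set (dist R X) -> term R X).

Definition trace_equiv (O : Type) (out : term R X -> O) (x y : X) : Prop :=
  forall w : seq A, out (run t tau (Var x) w) = out (run t tau (Var y) w).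

Definition may_must_equiv := trace_equiv (@out_may_must R X).
Definition may_equiv := trace_equiv (@out_may R X).
Definition must_equiv := trace_equiv (@out_must R X).

End TraceEquivalences.

(* Main.v *)
(** Let V_w(x) be the output of x^w. By linearity, a term denoting a
    distribution D outputs the expectation E_D[V_w] after w, so V_(aw)(x) is 0
    if t(x)(a) is empty, and otherwise the maximum (may) or minimum (must) of
    E_D[V_w] over D in t(x)(a). By induction on w, V_w is constant on the
    classes of a convex bisimulation: E-related distributions then have equal
    expectations of V_w, and the expectation under a convex combination never
    beats the extremum over the combined distributions. *)

Require Import Defs.
From HB Require Import structures.
From mathcomp Require Import all_boot all_order all_algebra.
From mathcomp Require Import boolp classical_sets functions cardinality.
From mathcomp Require Import fsbigop reals interval_inference.

Local Open Scope classical_set_scope.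
Local Open Scope ring_scope.

Set Implicit Arguments.
Unset Strict Implicit.
Unset Printing Implicit Defensive.

Import Order.TTheory GRing.Theory Num.Theory.

(** * Expectations under finitely supported distributions *)

Section Expectation.
Variables (R : realType) (X : choiceType).
Implicit Types (D : dist R X) (f : X -> R).

Definition expect D f : R := \sum_(x \in setT) D x * f x.

Lemma expect_seq D f (s : seq X) : uniq s ->
  (forall x, D x != 0 -> x \in s) -> expect D f = \sum_(x <- s) D x * f x.
Proof.
move=> us Ds; apply: sum_supp => // x.
by have [->|/Ds//] := eqVneq (D x) 0; rewrite mul0r eqxx.
Qed.

Lemma prob_seq D (C : set X) (s : seq X) : uniq s ->
  (forall x, D x != 0 -> x \in s) -> prob D C = \sum_(x <- s | x \in C) D x.
Proof.
move=> us Ds; rewrite /prob fsbig_mkcond [RHS]big_mkcond /=.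
apply: sum_supp => // x; rewrite /patch.
by case: ifP => _; [exact: Ds | rewrite eqxx].
Qed.

(** One list containing all the supports turns expectations under several distributions into sums
    over the same index. *)
Lemma common_supp n (F : 'I_n -> dist R X) :
  exists2 s : seq X, uniq s & forall i x, F i x != 0 -> x \in s.
Proof.
have /choice[s sP] i : exists s : seq X, forall x, F i x != 0 -> x \in s.
  by have [s _ sP] := finite_supp_seq (mass_finite (F i)); exists s.
exists (undup (flatten [seq s i | i : 'I_n])); first exact: undup_uniq.
move=> i x Fx; rewrite mem_undup; apply/flattenP; exists (s i).
  by rewrite map_f ?mem_enum.
exact: sP.
Qed.

Lemma common_supp2 D D' : exists s : seq X,
  [/\ uniq s, forall x, D x != 0 -> x \in s & forall x, D' x != 0 -> x \in s].
Proof.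
have [s us sP] := common_supp (fun i : 'I_2 => if val i == 0%N then D else D').
by exists s; split=> // x; [exact: (sP ord0) | exact: (sP ord_max)].
Qed.

Lemma expect_dirac f x : expect (dirac x) f = f x.
Proof.
rewrite (@expect_seq _ _ [:: x]) //=.
  by rewrite big_seq1 eqxx mul1r.
by move=> y; rewrite inE; have [//|_] := eqVneq y x; rewrite eqxx.
Qed.

Lemma expect_mix p D1 D2 f : expect (mix p D1 D2) f =
  p%:num * expect D1 f + (1 - p%:num) * expect D2 f.
Proof.
have [s [us s1 s2]] := common_supp2 D1 D2.
rewrite !(@expect_seq _ _ s) // => [|x /=].
  by rewrite !mulr_sumr -big_split; apply: eq_bigr => x _; rewrite mulrDl !mulrA.
have [->|/s1//] := eqVneq (D1 x) 0; have [->|/s2//] := eqVneq (D2 x) 0.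
by rewrite !mulr0 addr0 eqxx.
Qed.

Lemma expect_sum n (p : 'I_n -> R) (F : 'I_n -> dist R X) D f :
  (forall x, D x = \sum_i p i * F i x) ->
  expect D f = \sum_i p i * expect (F i) f.
Proof.
move=> DE; have [s us sF] := common_supp F.
rewrite (@expect_seq _ _ s) // => [|x]; last first.
  apply: contraNT => xs; rewrite DE big1// => i _.
  have [->|/sF] := eqVneq (F i x) 0; first by rewrite mulr0.
  by rewrite (negbTE xs).
under [RHS]eq_bigr => i _ do rewrite (expect_seq f us (@sF i)) mulr_sumr.
rewrite exchange_big; apply: eq_bigr => x _ /=; rewrite DE mulr_suml.
by apply: eq_bigr => i _; rewrite mulrA.
Qed.

(** Since [f] is constant on classes, grouping the sum by classes leaves an expression in class
    probabilities only. *)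
Lemma expect_related (E : X -> X -> Prop) D D' f :
  RelationClasses.Equivalence E -> (forall x y, E x y -> f x = f y) ->
  dist_related E D D' -> expect D f = expect D' f.
Proof.
move=> [Er Es Et] fE DD'.
have [s [us sD sD']] := common_supp2 D D'.
(* r picks a canonical representative of each class *)
pose r x := choose (fun y => `[<E x y>]) x.
have Exr x : E x (r x).
  exact/asboolP/(@chooseP _ (fun y => `[<E x y>]))/asboolP/Er.
have rE x y : (r x == r y) = (y \in [set z | E (r x) z]).
  apply/eqP/idP => [rxy|/set_mem /= xy].
    by apply/mem_set => /=; rewrite rxy; exact: Es.
  have {}xy : E x y := Et _ _ _ (Exr x) xy.
  (* The value of [choose] depends neither on the witness nor on how the predicate is presented, and
     [E x] and [E y] are the same predicate. *)
  rewrite /r (@choose_id _ _ x y) ?(asboolT (Er _)) ?(asboolT xy)//.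
  apply: eq_choose => z; apply/asbool_equiv_eq; split; apply: Et => //.
  exact: Es.
have by_class (D0 : dist R X) : (forall x, D0 x != 0 -> x \in s) ->
    expect D0 f = \sum_(z <- undup (map r s)) prob D0 [set y | E z y] * f z.
  move=> sD0; rewrite (expect_seq f us sD0).
  (* The term of [x] is filed under its representative [r x], then the two sums are exchanged. *)
  transitivity (\sum_(z <- undup (map r s)) \sum_(x <- s)
      if r x == z then D0 x * f x else 0).
    rewrite exchange_big; apply: eq_big_seq => x xs /=.
    rewrite (bigD1_seq (r x)) ?undup_uniq ?mem_undup ?map_f //= eqxx.
    by rewrite big1 ?addr0 // => z; rewrite eq_sym => /negbTE ->.
  apply: eq_big_seq => z; rewrite mem_undup => /mapP[y _ ->].
  rewrite (prob_seq _ us sD0) mulr_suml [RHS]big_mkcond.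
  apply: eq_bigr => x _; rewrite eq_sym rE.
  by case: ifP => // /set_mem /= /fE <-.
rewrite !by_class //; apply: eq_bigr => z _; congr (_ * _).
by apply: DD'; exists z.
Qed.

End Expectation.

(** * Outputs after a trace, for a generic interpretation of [Oplus] *)

Section Out.
Variables (R : realType) (op : R -> R -> R) (X : Type).

(** Up to conversion, [Num.max] gives [out_may] and [Num.min] gives [out_must], so one argument
    serves both. *)
Fixpoint out (s : term R X) : R :=
  match s with
  | Var _ => 1
  | Star => 0
  | Oplus s1 s2 => op (out s1) (out s2)
  | Plus p s1 s2 => p%:num * out s1 + (1 - p%:num) * out s2
  end.

End Out.

Section Outcomes.
Variables (R : realType) (op : R -> R -> R).
Variables (A : Type) (X : choiceType) (t : nplts R A X).
Variable tau : set (dist R X) -> term R X.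
Hypothesis tauP : is_tau_choice tau.

Definition value w x : R := out op (run t tau (Var x) w).

Lemma run_Oplus w s1 s2 :
  run t tau (Oplus s1 s2) w = Oplus (run t tau s1 w) (run t tau s2 w).
Proof. by elim: w s1 s2 => //= a w IH s1 s2; rewrite IH. Qed.

Lemma run_Plus w p s1 s2 :
  run t tau (Plus p s1 s2) w = Plus p (run t tau s1 w) (run t tau s2 w).
Proof. by elim: w s1 s2 => //= a w IH s1 s2; rewrite IH. Qed.

Lemma run_Star w : run t tau Star w = Star.
Proof. by elim: w. Qed.

Lemma out_denotes w d D :
  denotes d D -> out op (run t tau d w) = expect D (value w).
Proof.
elim=> [x|p d1 d2 D1 D2 _ IH1 _ IH2]; first by rewrite expect_dirac.
by rewrite run_Plus expect_mix /= IH1 IH2.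
Qed.

(* The sign eps treats max (eps = 1) and min (eps = -1) together. *)
Variable eps : R.
Hypothesis op_ubl : forall u v, eps * u <= eps * op u v.
Hypothesis op_ubr : forall u v, eps * v <= eps * op u v.
Hypothesis op_or : forall u v, op u v = u \/ op u v = v.

(** The accumulator [d] is an arbitrary term because the left-nested fold replaces it by
    [Oplus d e], which denotes no distribution. *)
Lemma out_foldl w d ds Ds : List.Forall2 (@denotes R X) ds Ds ->
  let u := out op (run t tau (foldl (@Oplus R X) d ds) w) in
  [/\ eps * out op (run t tau d w) <= eps * u,
      forall D, List.In D Ds -> eps * expect D (value w) <= eps * u
    & u = out op (run t tau d w) \/
      exists2 D, List.In D Ds & u = expect D (value w)].
Proof.
move=> H; elim: H d => [|e D {}ds {}Ds eD _ IH] d /=; first by split=> //; left.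
have [] := IH (Oplus d e); set u := out op (run _ _ (foldl _ _ _) _).
rewrite run_Oplus /=.
rewrite (out_denotes w eD) => ub ubDs att; split.
- exact: le_trans ub.
- by move=> D' [<-|/ubDs//]; exact: le_trans ub.
- case: att => [->|[D' ? ?]]; last by right; exists D'; [right|].
  have [->|->] := op_or (out op (run t tau d w)) (expect D (value w)).
    by left.
  by right; exists D; [left|].
Qed.

Lemma value_cons a w x (v := value (a :: w) x) :
  [/\ forall D, t x a D -> eps * expect D (value w) <= eps * v
    & (t x a = set0 /\ v = 0) \/
      exists2 D, t x a D & v = expect D (value w)].
Proof.
rewrite {}/v /value /=; case: (tauP (trans_finite t x a)).
  by split=> //; left; rewrite run_Star.
move=> D Ds d ds H; inversion_clear H as [|? ? ? ? dD dsDs].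
have [] := out_foldl w d dsDs; set u := out op (run _ _ (foldl _ _ _) _).
rewrite (out_denotes w dD) => ub ubDs att; split.
  by move=> D' /= [<-//|/ubDs].
right; case: att => [->|[D' ? ?]]; first by exists D => //; left.
by exists D' => //; right.
Qed.

Lemma conv_hull_bound (S : set (dist R X)) f b D :
  (forall D', S D' -> eps * expect D' f <= b) -> conv_hull S D ->
  eps * expect D f <= b.
Proof.
move=> Sb [n [p [F [p0 p1 FS DE]]]]; rewrite (expect_sum f DE) mulr_sumr.
rewrite -[b]mul1r -p1 mulr_suml; apply: ler_sum => i _.
by rewrite mulrCA ler_wpM2l// Sb.
Qed.

(** Empty weights cannot sum to 1. Hence a state without [a]-transitions is never bisimilar to one
    that has some. *)
Lemma conv_hull0 D : ~ conv_hull (set0 : set (dist R X)) D.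
Proof.
move=> [[|n] [p [F [_ p1 F0 _]]]]; last exact: F0 ord0.
by move/eqP: p1; rewrite big_ord0 eq_sym oner_eq0.
Qed.

(** * Invariance of outputs under convex bisimulation *)

Hypothesis eps_neq0 : eps != 0.

Lemma value_bisim E : convex_prob_bisimulation t E ->
  forall w x y, E x y -> value w x = value w y.
Proof.
move=> [Eeq Eb]; have [_ Es _] := Eeq.
elim=> [//|a w IH].
(* By symmetry of [E] one inequality suffices, and [eps] cancels. *)
suff half x y : E x y -> eps * value (a :: w) x <= eps * value (a :: w) y.
  move=> x y xy; apply: (mulfI eps_neq0); apply: le_anti.
  by rewrite !half//; exact: Es.
move=> xy; have [_ attx] := value_cons a w x.
have [uby atty] := value_cons a w y.
case: attx => [[tx0 ->]|[D xD ->]].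
  case: atty => [[_ ->]//|[D yD _]].
  have [D'] := Eb _ _ (Es _ _ xy) _ _ yD.
  by rewrite tx0 => /conv_hull0.
(* The extremal [D] at [x] is matched in the hull at [y] with the same expectation, which the value
   at [y] bounds. *)
have [D' yD' DD'] := Eb _ _ xy _ _ xD.
rewrite (expect_related Eeq IH DD'); exact: conv_hull_bound yD'.
Qed.

End Outcomes.

(** A matching distribution is its own one-point convex combination; this leaves only the convex
    case. *)
Lemma prob_bisimulation_convex (R : realType) (A : Type) (X : choiceType)
    (t : nplts R A X) E :
  prob_bisimulation t E -> convex_prob_bisimulation t E.
Proof.
move=> [Eeq Eb]; split=> // x y xy a D xD.
have [D' yD' DD'] := Eb _ _ xy _ _ xD; exists D' => //.
exists 1%N, (fun=> 1), (fun=> D'); split=> // [|z]; first by rewrite big_ord1.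
by rewrite big_ord1 mul1r.
Qed.

(** * Interval outputs and the three equivalences *)

Lemma itv01_inj (R : realType) (I J : itv01 R) :
  lo I = lo J -> hi I = hi J -> I = J.
Proof.
case: I J => [u v b] [u' v' b'] /= uu' vv'; subst u' v'.
by congr Itv01Of; exact: bool_irrelevance.
Qed.

Lemma lo_out_may_must (R : realType) (X : Type) (s : term R X) :
  lo (out_may_must s) = out_must s.
Proof. by elim: s => //= [s1 -> s2 ->|p s1 -> s2 ->]. Qed.

Lemma hi_out_may_must (R : realType) (X : Type) (s : term R X) :
  hi (out_may_must s) = out_may s.
Proof. by elim: s => //= [s1 -> s2 ->|p s1 -> s2 ->]. Qed.

Theorem theorem7p7 (R : realType) (A : Type) (X : choiceType)
    (t : nplts R A X) (tau : set (dist R X) -> term R X)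
    (htau : is_tau_choice tau) (x y : X)
    (hxy : prob_bisimilar t x y \/ convex_prob_bisimilar t x y) :
  may_must_equiv t tau x y /\ may_equiv t tau x y /\ must_equiv t tau x y.
Proof.
have {hxy} [E Eb xy] : convex_prob_bisimilar t x y.
  by case: hxy => // -[E /prob_bisimulation_convex Eb xy]; exists E.
have may : may_equiv t tau x y.
  move=> w; apply: (@value_bisim R Num.max _ _ t tau htau 1) Eb w _ _ xy.
  - by move=> u v; rewrite !mul1r le_max lexx.
  - by move=> u v; rewrite !mul1r le_max lexx orbT.
  - by move=> u v; rewrite maxEle; case: ifP; [right|left].
  - exact: oner_neq0.
have must : must_equiv t tau x y.
  move=> w; apply: (@value_bisim R Num.min _ _ t tau htau (-1)) Eb w _ _ xy.
  - by move=> u v; rewrite !mulN1r lerN2 ge_min lexx.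
  - by move=> u v; rewrite !mulN1r lerN2 ge_min lexx orbT.
  - by move=> u v; rewrite minEle; case: ifP; [left|right].
  - by rewrite oppr_eq0 oner_neq0.
(* The endpoints of the may-must output are the must and may outputs. *)
split=> // w; apply: itv01_inj; first by rewrite !lo_out_may_must must.
by rewrite !hi_out_may_must may.
Qed.
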